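(* Let $g_1,g_2\in\mathcal{S}(\mathbb{Z}^n)$, $\alpha\in\ell^\infty(\mathbb{Z}^n)$, and let $\varsigma(m,w)=\alpha(m)$ for $(m,w)\in\mathbb{Z}^n\times\mathbb{T}^n$. Then for all $f\in\ell^2(\mathbb{Z}^n)$, $$\mathfrak{L}^{g_1,g_2}_\varsigma f(k)=\int_{\mathbb{T}^n}\big((\alpha\,(M_w\tilde{g_1}*f))*M_wg_2\big)(k)\,dw,\qquad k\in\mathbb{Z}^n,$$ and for all $f,h\in\ell^2(\mathbb{Z}^n)$, $$\langle\mathfrak{L}^{g_1,g_2}_\varsigma f,h\rangle_{\ell^2(\mathbb{Z}^n)}=\sum_{k\in\mathbb{Z}^n}\alpha(k)\,p_{g_1,g_2}(f,h)(k),$$ where $p_{g_1,g_2}(f,h)$ is the paraproduct of $f$ and $h$ with respect to the windows $g_1$ and $g_2$.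
   Context: $\mathbb{T}^n$ is the torus with normalized Haar measure $dw$; $\mathcal{S}(\mathbb{Z}^n)$ is the space of rapidly decreasing functions on $\mathbb{Z}^n$; $*$ is convolution on $\mathbb{Z}^n$. $T_mf(k)=f(k-m)$, $M_wf(k)=e^{2\pi i w\cdot k}f(k)$, $V_gf(m,w)=\langle f,M_wT_mg\rangle_{\ell^2(\mathbb{Z}^n)}=\sum_{k\in\mathbb{Z}^n}f(k)\overline{g(k-m)}e^{-2\pi i w\cdot k}$. The localization operator with symbol $\varsigma$ and windows $g_1,g_2$ is given by $$\langle\mathfrak{L}^{g_1,g_2}_\varsigma f,h\rangle_{\ell^2(\mathbb{Z}^n)}=\sum_{m\in\mathbb{Z}^n}\int_{\mathbb{T}^n}\varsigma(m,w)\,V_{g_1}f(m,w)\,\overline{V_{g_2}h(m,w)}\,dw,\qquad f,h\in\ell^2(\mathbb{Z}^n).$$ $\tilde{g_1}(k)=\overline{g_1(-k)}$. The paraproduct is $$p_{g_1,g_2}(f,h)(k)=\int_{\mathbb{T}^n}(M_w\tilde{g_1}*f)(k)\;\overline{\big(\overline{(M_wg_2)(-\,\cdot)}*h\big)(k)}\,dw,\qquad k\in\mathbb{Z}^n,$$ where $(M_wg_2)(-\,\cdot)$ is the function $j\mapsto (M_wg_2)(-j)$. *)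

(* Defs.v *)
From HB Require Import structures.
From mathcomp Require Import all_boot all_order all_algebra.
From mathcomp Require Import all_classical all_reals all_analysis.
From mathcomp Require Import complex.

Set Implicit Arguments.
Unset Strict Implicit.
Unset Printing Implicit Defensive.

Import Order.TTheory GRing.Theory Num.Theory.
Import numFieldNormedType.Exports.
Import complex.ComplexField.Normc.

Local Open Scope classical_set_scope.
Local Open Scope complex_scope.
Local Open Scope ring_scope.

Notation Zn n := 'rV[int]_n.

(* The torus R^n/Z^n is represented by its fundamental domain [0, 1]^n inside
   R^n: normalized Haar measure becomes the n-fold product of the uniform
   probability on [0, 1], which gives no mass to the rest of R^n. *)
Notation torus R n := (n.-tuple (measurableTypeR R)).

Definition torus_cons (R : realType) (n : nat)
    (p : measurableTypeR R * torus R n) : torus R n.+1 :=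
  [tuple of p.1 :: p.2].

Lemma measurable_torus_cons (R : realType) (n : nat) :
  measurable_fun [set: measurableTypeR R * torus R n] (@torus_cons R n).
Proof. exact: measurable_cons. Qed.

HB.instance Definition _ (R : realType) (n : nat) :=
  isMeasurableFun.Build _ _ _ _ (@torus_cons R n)
    (@measurable_torus_cons R n).

Fixpoint haar (R : realType) (n : nat) : probability (torus R n) R :=
  match n with
  | 0%N => \d_([tuple] : torus R 0)
  | n'.+1 => distribution (uniform_prob (@ltr01 R) \x haar R n')%E
                          (@torus_cons R n')
  end.

Definition torus_integral (R : realType) (n : nat) (F : torus R n -> R[i]) :
    R[i] :=
  (\int[haar R n]_w complex.Re (F w)) +i* (\int[haar R n]_w complex.Im (F w)).

(* Unconditional sums over Z^n; as for the Lebesgue integral, the value is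
   meaningful only when the family is absolutely summable. *)
Definition Zn_rsum (R : realType) (n : nat) (u : Zn n -> R) : R :=
  fine (\esum_(k in [set: Zn n]) (Num.max (u k) 0)%:E)
  - fine (\esum_(k in [set: Zn n]) (Num.max (- u k) 0)%:E).

Definition Zn_sum (R : realType) (n : nat) (u : Zn n -> R[i]) : R[i] :=
  Zn_rsum (fun k => complex.Re (u k)) +i* Zn_rsum (fun k => complex.Im (u k)).

Definition in_l2 (R : realType) (n : nat) (f : Zn n -> R[i]) : Prop :=
  (\esum_(k in [set: Zn n]) (normc (f k) ^+ 2)%:E < +oo)%E.

Definition in_linfty (R : realType) (n : nat) (f : Zn n -> R[i]) : Prop :=
  exists M : R, forall k, normc (f k) <= M.

Definition Zn_norm (R : realType) (n : nat) (k : Zn n) : R :=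
  Num.sqrt (\sum_(i < n) ((k 0 i)%:~R : R) ^+ 2).

Definition rapidly_decreasing (R : realType) (n : nat) (g : Zn n -> R[i]) :
    Prop :=
  forall N : nat, exists C : R,
    forall k, (1 + Zn_norm R k) ^+ N * normc (g k) <= C.

Definition l2_inner (R : realType) (n : nat) (f h : Zn n -> R[i]) : R[i] :=
  Zn_sum (fun k => f k * (h k)^*%C).

Definition convolution (R : realType) (n : nat) (f g : Zn n -> R[i]) :
    Zn n -> R[i] :=
  fun k => Zn_sum (fun j => f (k - j) * g j).

Definition pairing (R : realType) (n : nat) (w : torus R n) (k : Zn n) : R :=
  \sum_(i < n) tnth w i * (k 0 i)%:~R.

(* exp(2 pi i t) *)
Definition cis2pi (R : realType) (t : R) : R[i] :=
  cos (2 * pi * t) +i* sin (2 * pi * t).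

Definition translation (R : realType) (n : nat) (m : Zn n)
    (f : Zn n -> R[i]) : Zn n -> R[i] :=
  fun k => f (k - m).

Definition modulation (R : realType) (n : nat) (w : torus R n)
    (f : Zn n -> R[i]) : Zn n -> R[i] :=
  fun k => cis2pi (pairing w k) * f k.

Definition stft (R : realType) (n : nat) (g f : Zn n -> R[i]) (m : Zn n)
    (w : torus R n) : R[i] :=
  l2_inner f (modulation w (translation m g)).

Definition involution (R : realType) (n : nat) (g : Zn n -> R[i]) :
    Zn n -> R[i] :=
  fun k => (g (- k))^*%C.

(* u is the value at f of the operator with symbol s and windows g1, g2: it
   is the element of l^2 representing the defining sesquilinear form, hence
   unique when it exists. *)
Definition is_localization (R : realType) (n : nat)
    (s : Zn n -> torus R n -> R[i]) (g1 g2 f u : Zn n -> R[i]) : Prop :=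
  in_l2 u /\
  forall h, in_l2 h ->
    l2_inner u h =
    Zn_sum (fun m => torus_integral (fun w =>
      s m w * stft g1 f m w * (stft g2 h m w)^*%C)).

Definition localization (R : realType) (n : nat)
    (s : Zn n -> torus R n -> R[i]) (g1 g2 f : Zn n -> R[i]) :
    Zn n -> R[i] :=
  xget (fun=> 0) [set u | is_localization s g1 g2 f u].

Definition paraproduct (R : realType) (n : nat) (g1 g2 f h : Zn n -> R[i]) :
    Zn n -> R[i] :=
  fun k => torus_integral (fun w =>
    convolution (modulation w (involution g1)) f k
    * (convolution (fun j => (modulation w g2 (- j))^*%C) h k)^*%C).

(* Main.v *)
From HB Require Import structures.
Require Import Defs.
From mathcomp Require Import all_boot all_order all_algebra.
From mathcomp Require Import all_classical all_reals all_analysis.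
From mathcomp Require Import measurable_realfun complex ring lra.
Import Order.TTheory GRing.Theory Num.Theory.
Import numFieldNormedType.Exports.
Import complex.ComplexField.Normc.
Set Implicit Arguments.
Unset Strict Implicit.
Unset Printing Implicit Defensive.
Local Open Scope classical_set_scope.
Local Open Scope complex_scope.
Local Open Scope ring_scope.

(** With a symbol that depends on m only, the localization operator is a pointwise
    multiplication: it sends f to c f with

      c(k) = sum_m alpha(m) conj(g1(k - m)) g2(k - m)

    ([multiplier]).  For fixed m the short-time Fourier transform of f is, as a
    function of w, the Fourier series of the summable family
    u_m(k) = f(k) conj(g1(k - m)) ([stftE]); by Parseval's identity ([parseval])
    the integral over w of V_{g1} f(m, w) conj(V_{g2} h(m, w)) is therefore
    sum_k f(k) conj(h(k)) conj(g1(k - m)) g2(k - m) ([integral_stft]).  Multiplying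
    by alpha(m), summing over m and exchanging the two sums identifies the
    sesquilinear form of the operator with the one of multiplication by c
    ([multiplier_formula]).  As c is bounded, c f is square summable, so it is the
    value of the operator at f, which is unique because an element of l^2 is
    determined by its inner products with the point masses
    ([localization_multiplier]).

    Both claims follow.  Since M_w g1~ * f (m) = e(w.m) V_{g1} f(m, w), and the
    second factor of the paraproduct carries the same unimodular factor, the
    paraproduct at m is exactly the integral of V_{g1} f conj(V_{g2} h)
    ([paraproductE]).  In the first formula, integrating the convolution over w
    term by term leaves sum_m alpha(m) g2(k - m) times the k-th Fourier
    coefficient of the series of u_m, that is c(k) f(k) ([multiplier_integral]).

    All exchanges of sums and integrals are instances of Fubini's theorem
    ([cfubini]): a sum over Z^n is an integral against counting measure
    ([Zn_sum_cint]).  Their hypotheses hold because rapidly decreasing windows are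
    summable ([rapidly_decreasing_in_l1]) and square-summable functions are
    bounded. *)

(** * The modulus on R[i] and complex-valued integrals *)

Section normc_lemmas.
Context {R : realType}.
Implicit Types z : R[i].

Lemma normc_ge0 z : 0 <= normc z.
Proof. by case: z => a b; exact: sqrtr_ge0. Qed.

Lemma normc_conj z : normc z^*%C = normc z.
Proof. by case: z => a b /=; rewrite sqrrN. Qed.

Lemma conjcM (x y : R[i]) : (x * y)^*%C = x^*%C * y^*%C.
Proof. exact: rmorphM. Qed.

Lemma Re_le_normc z : `|complex.Re z| <= normc z.
Proof. by case: z => a b /=; rewrite -sqrtr_sqr ler_wsqrtr// lerDl sqr_ge0. Qed.

Lemma Im_le_normc z : `|complex.Im z| <= normc z.
Proof. by case: z => a b /=; rewrite -sqrtr_sqr ler_wsqrtr// lerDr sqr_ge0. Qed.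

Lemma normc_le_ReIm z : normc z <= `|complex.Re z| + `|complex.Im z|.
Proof.
case: z => a b /=; rewrite -[leRHS]ger0_norm ?addr_ge0// -sqrtr_sqr ler_wsqrtr//.
by rewrite sqrrD !real_normK ?num_real// lerD2r lerDl mulrn_wge0// mulr_ge0.
Qed.

Lemma normc_cis2pi (t : R) : normc (cis2pi t) = 1.
Proof. by rewrite /= cos2Dsin2 sqrtr1. Qed.

Lemma cis2piD (s t : R) : cis2pi (s + t) = cis2pi s * cis2pi t.
Proof. by rewrite /cis2pi mulrDr cosD sinD; simpc; rewrite [X in _ +i* X]addrC. Qed.

Lemma cis2pi0 : cis2pi 0 = 1 :> R[i].
Proof. by rewrite /cis2pi mulr0 cos0 sin0. Qed.

Lemma conj_cis2pi (t : R) : (cis2pi t)^*%C = cis2pi (- t).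
Proof. by rewrite /cis2pi mulrN cosN sinN. Qed.

End normc_lemmas.

Section complex_measurable.
Context d (T : measurableType d) (R : realType).
Implicit Types F G : T -> R[i].

Definition cmeasurable F :=
  measurable_fun setT (fun x => complex.Re (F x)) /\
  measurable_fun setT (fun x => complex.Im (F x)).

Lemma cmeasurable_cst z : cmeasurable (fun=> z).
Proof. by split; exact: measurable_cst. Qed.

Lemma cmeasurableM F G :
  cmeasurable F -> cmeasurable G -> cmeasurable (fun x => F x * G x).
Proof.
move=> [F1 F2] [G1 G2]; split.
  rewrite (_ : (fun _ => _) = (fun x => complex.Re (F x) * complex.Re (G x)
    - complex.Im (F x) * complex.Im (G x))); last first.
    by apply/funext => x; case: (F x); case: (G x).
  by apply: measurable_funB; exact: measurable_funM.
rewrite (_ : (fun _ => _) = (fun x => complex.Re (F x) * complex.Im (G x)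
  + complex.Im (F x) * complex.Re (G x))); last first.
  by apply/funext => x; case: (F x); case: (G x).
by apply: measurable_funD; exact: measurable_funM.
Qed.

Lemma cmeasurable_conj F : cmeasurable F -> cmeasurable (fun x => (F x)^*%C).
Proof.
move=> [F1 F2]; split.
  by rewrite (_ : (fun _ => _) = (fun x => complex.Re (F x)))//;
    apply/funext => x; case: (F x).
rewrite (_ : (fun _ => _) = (fun x => - complex.Im (F x))).
  exact: measurableT_comp.
by apply/funext => x; case: (F x).
Qed.

Lemma measurable_normc F : cmeasurable F ->
  measurable_fun setT (fun x => (normc (F x))%:E).
Proof.
move=> [F1 F2]; apply/measurable_EFinP.
rewrite (_ : (fun _ => _) = (fun x => Num.sqrt (complex.Re (F x) ^+ 2
    + complex.Im (F x) ^+ 2))); last by apply/funext => x; case: (F x).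
apply: measurableT_comp => //.
  by apply: continuous_measurable_fun; exact: sqrt_continuous.
by apply: measurable_funD; exact: measurable_funX.
Qed.

End complex_measurable.

Section complex_integral.
Context d (T : measurableType d) (R : realType).
Variable mu : {measure set T -> \bar R}.
Implicit Types F G : T -> R[i].

Definition cint F : R[i] :=
  (\int[mu]_x complex.Re (F x)) +i* (\int[mu]_x complex.Im (F x)).

Definition cintegrable F :=
  cmeasurable F /\ (\int[mu]_x (normc (F x))%:E < +oo)%E.

Lemma cintegrable_le F (b : T -> R) : cmeasurable F ->
  measurable_fun setT b -> (forall x, normc (F x) <= b x) ->
  (\int[mu]_x (b x)%:E < +oo)%E -> cintegrable F.
Proof.
move=> mF mb Fb ib; split => //; apply: le_lt_trans ib.
apply: ge0_le_integral => //.
- by move=> x _; rewrite lee_fin normc_ge0.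
- exact: measurable_normc.
- exact/measurable_EFinP.
- by move=> x _; rewrite lee_fin.
Qed.

Lemma cintegrable_Re F : cintegrable F ->
  mu.-integrable setT (fun x => (complex.Re (F x))%:E).
Proof.
move=> [mF iF]; apply/integrableP; split; first exact/measurable_EFinP/mF.1.
apply: le_lt_trans iF; apply: ge0_le_integral => //.
- by apply/measurable_EFinP/measurableT_comp => //; exact: mF.1.
- exact: measurable_normc.
- by move=> x _; rewrite lee_fin Re_le_normc.
Qed.

Lemma cintegrable_Im F : cintegrable F ->
  mu.-integrable setT (fun x => (complex.Im (F x))%:E).
Proof.
move=> [mF iF]; apply/integrableP; split; first exact/measurable_EFinP/mF.2.
apply: le_lt_trans iF; apply: ge0_le_integral => //.
- by apply/measurable_EFinP/measurableT_comp => //; exact: mF.2.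
- exact: measurable_normc.
- by move=> x _; rewrite lee_fin Im_le_normc.
Qed.

Lemma cintegrable_ReIm F :
  mu.-integrable setT (fun x => (complex.Re (F x))%:E) ->
  mu.-integrable setT (fun x => (complex.Im (F x))%:E) -> cintegrable F.
Proof.
move=> /integrableP[mR iR] /integrableP[mI iI].
have mF : cmeasurable F by split; exact/measurable_EFinP.
split => //; apply: le_lt_trans (lte_add_pinfty iR iI).
have mRn := measurableT_comp (@abse_measurable R setT) mR.
have mIn := measurableT_comp (@abse_measurable R setT) mI.
rewrite -ge0_integralD//; apply: ge0_le_integral => //.
- by move=> x _; rewrite lee_fin normc_ge0.
- exact: measurable_normc.
- exact: emeasurable_funD.
- by move=> x _; rewrite /= -EFinD lee_fin normc_le_ReIm.
Qed.

Lemma cintZ z F : cintegrable F -> cint (fun x => z * F x) = z * cint F.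
Proof.
move=> iF; have iR := cintegrable_Re iF; have iI := cintegrable_Im iF.
have iZ (r : R) f : mu.-integrable setT (EFin \o f) ->
    mu.-integrable setT (EFin \o (fun x => r * f x)).
  by move=> fi; exact: (integrableZl _ r fi).
case: z => a b; rewrite /cint; simpc; congr (_ +i* _).
- rewrite -!RintegralZl// -RintegralB//; [|exact: iZ..].
  by apply: eq_Rintegral => x _; case: (F x).
- rewrite -!RintegralZl// -RintegralD//; [|exact: iZ..].
  by apply: eq_Rintegral => x _; case: (F x).
Qed.

Lemma cint_conj F : cintegrable F ->
  cint (fun x => (F x)^*%C) = (cint F)^*%C.
Proof.
move=> iF; rewrite /cint /=; congr (_ +i* _).
  by apply: eq_Rintegral => x _; case: (F x).
rewrite -[RHS]mulN1r -RintegralZl//; last exact: cintegrable_Im.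
by apply: eq_Rintegral => x _; case: (F x) => a b; rewrite mulN1r.
Qed.

Lemma eq_cint F G : F =1 G -> cint F = cint G.
Proof. by move=> FG; congr cint; exact/funext. Qed.

(** The factor 2 comes from bounding the two components separately; it is
    harmless where the bound only serves to show finiteness. *)
Lemma normc_cint F : cintegrable F ->
  normc (cint F) <= 2 * fine (\int[mu]_x (normc (F x))%:E).
Proof.
move=> iF; have [mF lF] := iF.
have iN : mu.-integrable setT (EFin \o (fun x => normc (F x))).
  apply/integrableP; split; first exact: measurable_normc.
  by under eq_integral do rewrite /= ger0_norm ?normc_ge0//.
have iR := cintegrable_Re iF; have iI := cintegrable_Im iF.
apply: le_trans (normc_le_ReIm _) _; rewrite mulr_natl mulr2n /cint /=.
apply: lerD; apply: le_trans (le_normr_Rintegral _ _) _ => //.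
- apply: le_Rintegral => //; first exact: (integrable_norm iR).
  by move=> x _; exact: Re_le_normc.
- apply: le_Rintegral => //; first exact: (integrable_norm iI).
  by move=> x _; exact: Im_le_normc.
Qed.

End complex_integral.

Section complex_fubini.
Context d1 d2 (T1 : measurableType d1) (T2 : measurableType d2) (R : realType).
Variable m1 : {sigma_finite_measure set T1 -> \bar R}.
Variable m2 : {sigma_finite_measure set T2 -> \bar R}.

Let fine_integral d (T : measurableType d) (mu : {measure set T -> \bar R})
    (f : T -> \bar R) : measurable_fun setT f ->
  {ae mu, forall x, f x \is a fin_num} ->
  (\int[mu]_x (fine (f x))%:E = \int[mu]_x f x)%E.
Proof.
move=> mf fin; apply: ae_eq_integral => //.
  by apply/measurable_EFinP; exact: measurableT_comp.
by apply: filterS fin => x fx _; rewrite fineK.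
Qed.

Let Rfubini (f : T1 * T2 -> R) :
  (m1 \x m2)%E.-integrable setT (EFin \o f) ->
  \int[m1]_x \int[m2]_y f (x, y) = \int[m2]_y \int[m1]_x f (x, y).
Proof.
move=> fi; rewrite /Rintegral; congr fine.
rewrite fine_integral; last 2 first.
- exact: measurable_fubini_F fi.
- by apply: filterS (ae_integrable1 fi) => x; exact: integrable_fin_num.
rewrite fine_integral; last 2 first.
- exact: measurable_fubini_G fi.
- by apply: filterS (ae_integrable2 fi) => x; exact: integrable_fin_num.
exact: Fubini fi.
Qed.

Lemma cint_prod (F : T1 * T2 -> R[i]) : cintegrable (m1 \x m2)%E F ->
  cint (m1 \x m2)%E F = cint m1 (fun x => cint m2 (fun y => F (x, y))).
Proof.
have key (f : T1 * T2 -> R) : (m1 \x m2)%E.-integrable setT (EFin \o f) ->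
    \int[(m1 \x m2)%E]_z f z = \int[m1]_x \int[m2]_y f (x, y).
  move=> fi; rewrite /Rintegral -(integral12_prod_meas1 fi); congr fine.
  rewrite [RHS]fine_integral//; first exact: measurable_fubini_F fi.
  by apply: filterS (ae_integrable1 fi) => x; exact: integrable_fin_num.
by move=> iF; rewrite /cint !key//; [exact: cintegrable_Im|exact: cintegrable_Re].
Qed.

Variables (F : T1 * T2 -> R[i]) (b : T2 -> R).
Hypotheses (mF : cmeasurable F) (mb : measurable_fun setT b)
  (Fb : forall y, (\int[m1]_x (normc (F (x, y)))%:E <= (b y)%:E)%E)
  (ib : (\int[m2]_y (b y)%:E < +oo)%E).

Let iF : cintegrable (m1 \x m2)%E F.
Proof.
split => //; rewrite fubini_tonelli2//.
- apply: le_lt_trans ib; apply: ge0_le_integral => //.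
  + by move=> y _; apply: integral_ge0 => x _; rewrite lee_fin normc_ge0.
  + apply: (measurable_fun_fubini_tonelli_G (fun z => (normc (F z))%:E)) => //.
      exact: measurable_normc.
    by move=> z; rewrite lee_fin normc_ge0.
  + exact/measurable_EFinP.
  + by move=> y _; exact: Fb.
- exact: measurable_normc.
- by move=> z; rewrite lee_fin normc_ge0.
Qed.

(** The majorant [b] gives integrability on the product by Tonelli's theorem.  The
    inner integrals may fail to converge, but only on a null set. *)
Lemma cfubini : cint m1 (fun x => cint m2 (fun y => F (x, y))) =
                cint m2 (fun y => cint m1 (fun x => F (x, y))).
Proof.
rewrite /cint /=; congr (_ +i* _).
- by apply: (Rfubini (f := fun z => complex.Re (F z))); exact: cintegrable_Re.
- by apply: (Rfubini (f := fun z => complex.Im (F z))); exact: cintegrable_Im.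
Qed.

Lemma cintegrable_cint : cintegrable m1 (fun x => cint m2 (fun y => F (x, y))).
Proof.
have fine_int (h : T1 -> \bar R) : m1.-integrable setT h ->
    m1.-integrable setT (fun x => (fine (h x))%:E).
  move=> ih; apply: le_integrable (ih) => //.
    apply/measurable_EFinP; apply: measurableT_comp => //.
    exact: measurable_int ih.
  by move=> x _; case: (h x) => [r| |] //=; rewrite normr0 leey.
apply: cintegrable_ReIm => /=; apply: fine_int.
- exact: (integrable_fubini_F (cintegrable_Re iF)).
- exact: (integrable_fubini_F (cintegrable_Im iF)).
Qed.

End complex_fubini.

(** * Counting measure on Z^n *)

(** Z^n carries the discrete sigma-algebra, so that every function on it is
    measurable and sums over it can be treated as integrals. *)
HB.instance Definition _ := isPointed.Build int 0.

HB.instance Definition _ (n : nat) := @isMeasurable.Build default_measure_display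
  (Zn n) discrete_measurable discrete_measurable0
  discrete_measurableC discrete_measurableU.

Section counting_Zn.
Context {R : realType} {n : nat}.

Lemma measurable_Zn (A : set (Zn n)) : measurable A.
Proof. by []. Qed.

Lemma measurable_fun_Zn d (T : measurableType d) (f : Zn n -> T) D :
  measurable_fun D f.
Proof. by []. Qed.

Lemma sigma_finite_Zn : sigma_finite [set: Zn n] (@counting (Zn n) R).
Proof.
exists (fun i => [set k : Zn n | pickle k = i]).
  by apply/seteqP; split => // k _; exists (pickle k).
move=> i; split => //.
have fink : finite_set [set k : Zn n | pickle k = i].
  have [[k ki]|no] := pselect (exists k : Zn n, pickle k = i).
    apply: (@sub_finite_set _ _ [set k]) => // l /= li.
    by apply: (pcan_inj pickleK); rewrite li ki.
  by rewrite (_ : [set _ | _] = set0)//; apply/seteqP; split => // k ki; case: no; exists k.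
by rewrite /counting asboolT// ltry.
Qed.

(** A separate constant, because canonical structures are looked up by head symbol
    and [counting] already carries the sigma-finite structure of counting measure
    on nat. *)
Definition Zn_counting : set (Zn n) -> \bar R := counting.

HB.instance Definition _ := Measure.on Zn_counting.

HB.instance Definition _ := @Measure_isSigmaFinite.Build _ (Zn n) R
  Zn_counting sigma_finite_Zn.

Lemma integral_counting_Zn (f : Zn n -> \bar R) : (forall k, 0 <= f k)%E ->
  (\int[Zn_counting]_k f k = \esum_(k in [set: Zn n]) f k)%E.
Proof.
move=> f0; pose J i := [set k : Zn n | pickle k = i].
have J_inj i k l : J i k -> J i l -> k = l.
  by move=> /= <- /esym; exact: (pcan_inj pickleK).
have tJ : trivIset setT J.
  apply/trivIsetP => i j _ _ /eqP ij; apply/seteqP; split => // k [/= ki kj].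
  by case: ij; rewrite -ki.
have JT : [set: Zn n] = \bigcup_i J i.
  by apply/seteqP; split => // k _; exists (pickle k).
rewrite JT ge0_integral_bigcup// esum_bigcupT// -nneseries_esumT//; last first.
  by move=> i; exact: esum_ge0.
apply: eq_eseriesr => i _.
have [[k ki]|no] := pselect (exists k, J i k).
  have -> : J i = [set k].
    by apply/seteqP; split => [l li|l ->//]; exact: J_inj li ki.
  rewrite esum_set1// (eq_integral (cst (f k))); last first.
    by move=> l /[!inE]/= ->.
  rewrite integral_cst// [X in (_ * X)%E](_ : _ = 1%E) ?mule1//.
  by rewrite /= /Zn_counting /counting asboolT// fset_set1 finmap.cardfs1.
have -> : J i = set0 by apply/seteqP; split => // k ki; case: no; exists k.
by rewrite integral_set0 esum_set0.
Qed.

End counting_Zn.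

Section Zn_sum_theory.
Context {R : realType} {n : nat}.
Implicit Types (u v f h g : Zn n -> R[i]) (k m : Zn n).

Definition in_l1 u : Prop :=
  (\esum_(k in [set: Zn n]) (normc (u k))%:E < +oo)%E.

Lemma cmeasurable_Zn u : cmeasurable u.
Proof. by split; exact: measurable_fun_Zn. Qed.

Lemma in_l1P u : in_l1 u <-> cintegrable Zn_counting u.
Proof.
rewrite /cintegrable integral_counting_Zn; last by move=> k; rewrite lee_fin normc_ge0.
by split => [|[]//]; split => //; exact: cmeasurable_Zn.
Qed.

Lemma in_l1_le u (b : Zn n -> R) : (forall k, normc (u k) <= b k) ->
  (\esum_(k in [set: Zn n]) (b k)%:E < +oo)%E -> in_l1 u.
Proof. by move=> ub; apply: le_lt_trans; apply: le_esum => k _; rewrite lee_fin. Qed.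

(** Absolute summability is essential: otherwise the differences of truncated
    values on the two sides need not agree. *)
Lemma Zn_sum_cint u : in_l1 u -> Zn_sum u = cint Zn_counting u.
Proof.
move=> /in_l1P iu.
have key (r : Zn n -> R) : Zn_counting.-integrable setT (EFin \o r) ->
    Zn_rsum r = \int[Zn_counting]_k r k.
  move=> ir; rewrite /Zn_rsum /Rintegral integralE fineB; last 2 first.
  - exact: integrable_pos_fin_num ir.
  - exact: integrable_neg_fin_num ir.
  rewrite !integral_counting_Zn//.
  congr (fine _ - fine _); apply: eq_esum => k _.
    by rewrite funeposE /= -EFin_max.
  by rewrite funenegE /= -EFin_max.
by rewrite /Zn_sum /cint !key//; [exact: cintegrable_Im|exact: cintegrable_Re].
Qed.

Lemma eq_Zn_sum u v : u =1 v -> Zn_sum u = Zn_sum v.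
Proof. by move=> uv; congr Zn_sum; exact/funext. Qed.

Lemma Zn_sumZ z u : in_l1 u -> Zn_sum (fun k => z * u k) = z * Zn_sum u.
Proof.
move=> u1; rewrite !Zn_sum_cint//; first by apply: cintZ; exact/in_l1P.
apply: (@in_l1_le _ (fun k => normc z * normc (u k))).
  by move=> k; rewrite normcM.
rewrite -integral_counting_Zn; last first.
  by move=> k; rewrite lee_fin mulr_ge0// normc_ge0.
under eq_integral do rewrite EFinM.
rewrite ge0_integralZl//; last 2 first.
- by move=> k _; rewrite lee_fin normc_ge0.
- by rewrite lee_fin normc_ge0.
by rewrite lte_mul_pinfty ?lee_fin ?normc_ge0//; case/in_l1P : u1.
Qed.

Lemma esum_reindex (e : Zn n -> Zn n) (a : Zn n -> \bar R) : bijective e ->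
  (\esum_(k in [set: Zn n]) a (e k) = \esum_(k in [set: Zn n]) a k)%E.
Proof.
by move=> be; apply/esym/reindex_esum; rewrite setTT_bijective.
Qed.

Lemma Zn_sum_reindex (e : Zn n -> Zn n) u : bijective e ->
  Zn_sum (fun k => u (e k)) = Zn_sum u.
Proof.
move=> be; rewrite /Zn_sum /Zn_rsum.
rewrite (esum_reindex (fun k => (Num.max (complex.Re (u k)) 0)%:E) be).
rewrite (esum_reindex (fun k => (Num.max (- complex.Re (u k)) 0)%:E) be).
rewrite (esum_reindex (fun k => (Num.max (complex.Im (u k)) 0)%:E) be).
by rewrite (esum_reindex (fun k => (Num.max (- complex.Im (u k)) 0)%:E) be).
Qed.

Lemma bij_reflect m : bijective (fun k : Zn n => m - k).
Proof. by exists (fun k => m - k) => k; rewrite subKr. Qed.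

Lemma bij_translate m : bijective (fun k : Zn n => k - m).
Proof. by exists (fun k => k + m) => k; rewrite ?subrK ?addrK. Qed.

Lemma in_l1_reindex (e : Zn n -> Zn n) u : bijective e -> in_l1 u ->
  in_l1 (fun k => u (e k)).
Proof.
by move=> be; rewrite /in_l1 (esum_reindex (fun k => (normc (u k))%:E) be).
Qed.

Lemma in_l1_conj u : in_l1 u -> in_l1 (fun k => (u k)^*%C).
Proof. by apply: in_l1_le => k; rewrite normc_conj. Qed.

Lemma Zn_sum1 m u : (forall k, k != m -> u k = 0) -> Zn_sum u = u m.
Proof.
move=> u0.
have key (r : Zn n -> R) : (forall k, k != m -> r k = 0) -> (forall k, 0 <= r k) ->
    (\esum_(k in [set: Zn n]) (r k)%:E = (r m)%:E)%E.
  move=> rm r0; rewrite -(@esum_set1 R _ m (fun k => (r k)%:E)) ?lee_fin//.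
  rewrite [RHS]esum_mkcond; apply: eq_esum => k _.
  by case: ifPn => //; rewrite notin_setE => /eqP /rm ->.
have rkey (r : Zn n -> R) : (forall k, k != m -> r k = 0) -> Zn_rsum r = r m.
  move=> rm; rewrite /Zn_rsum !key/=.
  - case: (lerP 0 (r m)) => rm0.
    by rewrite (max_idPr _) ?oppr_le0// subr0.
  by rewrite (max_idPl _) ?oppr_ge0 ?ltW// sub0r opprK.
  - by move=> k /rm ->; rewrite oppr0 maxxx.
  - by move=> k; rewrite le_max lexx orbT.
  - by move=> k /rm ->; rewrite maxxx.
  - by move=> k; rewrite le_max lexx orbT.
rewrite /Zn_sum !rkey; last 2 first.
- by move=> k /u0 ->.
- by move=> k /u0 ->.
by case: (u m).
Qed.

Lemma le_esum1 (a : Zn n -> \bar R) m : (forall k, 0 <= a k)%E ->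
  (a m <= \esum_(k in [set: Zn n]) a k)%E.
Proof.
move=> a0; apply: esum_ge; exists [set m]; first by split => //; exact: finite_set1.
by rewrite fsbig_set1.
Qed.

Lemma in_l1_bounded u : in_l1 u -> in_linfty u.
Proof.
move=> u1; exists (fine (\esum_(k in [set: Zn n]) (normc (u k))%:E)) => k.
have S0 : (0 <= \esum_(k in [set: Zn n]) (normc (u k))%:E)%E.
  by apply: esum_ge0 => l _; rewrite lee_fin normc_ge0.
rewrite -lee_fin fineK ?ge0_fin_numE//.
by apply: (le_esum1 (a := fun l => (normc (u l))%:E)) => l; rewrite lee_fin normc_ge0.
Qed.

Lemma in_l2_mul f h : in_l2 f -> in_l2 h -> in_l1 (fun k => f k * h k).
Proof.
move=> f2 h2; apply: (@in_l1_le _ (fun k => normc (f k) ^+ 2 + normc (h k) ^+ 2)).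
  move=> k; rewrite normcM; have := normc_ge0 (f k); have := normc_ge0 (h k).
  by move: (normc _) (normc _) => a b a0 b0; nra.
under eq_esum do rewrite EFinD.
rewrite esumD; last 2 first.
- by move=> k _; rewrite lee_fin exprn_ge0// normc_ge0.
- by move=> k _; rewrite lee_fin exprn_ge0// normc_ge0.
exact: lte_add_pinfty.
Qed.

Lemma in_l2_conj f : in_l2 f -> in_l2 (fun k => (f k)^*%C).
Proof. by rewrite /in_l2; under [in X in _ -> X]eq_esum do rewrite normc_conj. Qed.

Lemma esumZl_lty (c : R) (a : Zn n -> R) : 0 <= c -> (forall k, 0 <= a k) ->
  (\esum_(k in [set: Zn n]) (a k)%:E < +oo)%E ->
  (\esum_(k in [set: Zn n]) (c * a k)%:E < +oo)%E.
Proof.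
move=> c0 a0 afin; rewrite -integral_counting_Zn; last first.
  by move=> k; rewrite lee_fin mulr_ge0.
under eq_integral do rewrite EFinM.
rewrite ge0_integralZl//.
- rewrite lte_mul_pinfty ?lee_fin// integral_counting_Zn//.
  by move=> k; rewrite lee_fin.
Qed.

Lemma in_linfty_mul_l1 u v : in_linfty u -> in_l1 v -> in_l1 (fun k => u k * v k).
Proof.
move=> [M uM] v1; apply: (@in_l1_le _ (fun k => `|M| * normc (v k))).
  move=> k; rewrite normcM ler_wpM2r ?normc_ge0//.
  exact: le_trans (uM k) (ler_norm _).
by apply: esumZl_lty => // k; exact: normc_ge0.
Qed.

Lemma in_linfty_mul_l2 u f : in_linfty u -> in_l2 f -> in_l2 (fun k => u k * f k).
Proof.
move=> [M uM] f2.
apply: (@le_lt_trans _ _ (\esum_(k in [set: Zn n]) (M ^+ 2 * normc (f k) ^+ 2)%:E)).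
  apply: le_esum => k _; rewrite lee_fin normcM exprMn ler_wpM2r ?exprn_ge0 ?normc_ge0//.
  by rewrite lerXn2r ?nnegrE ?normc_ge0//; apply: le_trans (uM k); exact: normc_ge0.
by apply: esumZl_lty => // [|k]; rewrite exprn_ge0// ?normc_ge0//;
  apply: le_trans (uM 0); exact: normc_ge0.
Qed.

Lemma in_l2_bounded f : in_l2 f -> in_linfty f.
Proof.
move=> f2; have [M fM] : in_linfty (fun k => f k * f k).
  exact/in_l1_bounded/in_l2_mul.
exists (1 + M) => k; have := fM k; have := normc_ge0 (f k).
by rewrite normcM; move: (normc _) => a; nra.
Qed.

Lemma normc_Zn_sum u : in_l1 u ->
  normc (Zn_sum u) <= 2 * fine (\esum_(k in [set: Zn n]) (normc (u k))%:E).
Proof.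
move=> u1; rewrite Zn_sum_cint//; apply: le_trans (normc_cint _) _.
  exact/in_l1P.
by rewrite integral_counting_Zn// => k; rewrite lee_fin normc_ge0.
Qed.

End Zn_sum_theory.

Section Zn_sum_cint_swap.
Context d (T : measurableType d) (R : realType) (n : nat).

(** The preimage of a set is the countable union of its slices times points. *)
Lemma measurable_fun_prod_Zn d' (T' : measurableType d') (F : T * Zn n -> T') :
  (forall k, measurable_fun setT (fun x => F (x, k))) -> measurable_fun setT F.
Proof.
move=> mF _ A mA; rewrite setTI.
(* Slices are indexed by the codes of the points of Z^n; other codes get set0. *)
rewrite (_ : F @^-1` A = \bigcup_i (if @unpickle (Zn n) i is Some k
    then ((fun x => F (x, k)) @^-1` A) `*` [set k] else set0)); last first.
  apply/seteqP; split => [[x k] Fxk|[x k] [i _]].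
    by exists (pickle k) => //; rewrite pickleK.
  by case: unpickle => // l [/= Fxl ->].
apply: bigcupT_measurable => i; case: unpickle => // k.
apply: measurableX; last exact: measurable_Zn.
by rewrite -[X in measurable X]setTI; exact: mF.
Qed.

Variables (mu : {sigma_finite_measure set T -> \bar R}).
Variables (F : T -> Zn n -> R[i]) (b : Zn n -> R).
Hypotheses (mF : forall k, cmeasurable (fun x => F x k))
  (Fl1 : forall x, in_l1 (F x))
  (Fb : forall k, (\int[mu]_x (normc (F x k))%:E <= (b k)%:E)%E)
  (bfin : (\esum_(k in [set: Zn n]) (b k)%:E < +oo)%E).

Let mFp : cmeasurable (fun z : T * Zn n => F z.1 z.2).
Proof. by split; apply: measurable_fun_prod_Zn => k; have [] := mF k. Qed.

Let b0 k : 0 <= b k.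
Proof.
rewrite -lee_fin; apply: le_trans (Fb k); apply: integral_ge0 => x _.
by rewrite lee_fin normc_ge0.
Qed.

Let bint : (\int[Zn_counting]_k (b k)%:E < +oo)%E.
Proof. by rewrite integral_counting_Zn. Qed.

Let sumE : (fun x => Zn_sum (F x)) = (fun x => cint Zn_counting (F x)).
Proof. by apply/funext => x; rewrite Zn_sum_cint. Qed.

Let mb : measurable_fun setT b. Proof. exact: measurable_fun_Zn. Qed.

Let nu : {sigma_finite_measure set (Zn n) -> \bar R} := Zn_counting.

Lemma cintegrable_Zn_sum : cintegrable mu (fun x => Zn_sum (F x)).
Proof.
rewrite sumE.
exact: (@cintegrable_cint _ _ _ _ R mu nu (fun z : T * Zn n => F z.1 z.2)
  b mFp mb Fb bint).
Qed.

Lemma cint_Zn_sum :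
  cint mu (fun x => Zn_sum (F x)) = Zn_sum (fun k => cint mu (fun x => F x k)).
Proof.
rewrite sumE; have := @cfubini _ _ _ _ R mu nu (fun z : T * Zn n => F z.1 z.2)
  b mFp mb Fb bint.
move=> ->; rewrite Zn_sum_cint//.
apply: (@in_l1_le _ _ _ (fun k => 2 * b k)).
  move=> k.
  have ik : cintegrable mu (fun x => F x k).
    by split; [exact: mF|apply: le_lt_trans (Fb k) _; rewrite ltry].
  apply: le_trans (normc_cint ik) _; rewrite ler_pM2l// -lee_fin fineK//.
  rewrite ge0_fin_numE; first by case: ik.
  by apply: integral_ge0 => x _; rewrite lee_fin normc_ge0.
exact: esumZl_lty.
Qed.

End Zn_sum_cint_swap.

Lemma Zn_sum_swap (R : realType) (n : nat) (F : Zn n -> Zn n -> R[i])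
    (b : Zn n -> R) : (forall m, in_l1 (F m)) ->
  (forall k, (\esum_(m in [set: Zn n]) (normc (F m k))%:E <= (b k)%:E)%E) ->
  (\esum_(k in [set: Zn n]) (b k)%:E < +oo)%E ->
  Zn_sum (fun m => Zn_sum (F m)) = Zn_sum (fun k => Zn_sum (fun m => F m k)).
Proof.
move=> Fl1 Fb bfin.
pose nu : {sigma_finite_measure set (Zn n) -> \bar R} := @Zn_counting R n.
have mF k : cmeasurable (fun m => F m k) by exact: cmeasurable_Zn.
have iFb k : (\int[nu]_m (normc (F m k))%:E <= (b k)%:E)%E.
  by rewrite integral_counting_Zn// => m; rewrite lee_fin normc_ge0.
rewrite Zn_sum_cint; last exact/in_l1P/(cintegrable_Zn_sum mF Fl1 iFb bfin).
rewrite (cint_Zn_sum mF Fl1 iFb bfin); apply: eq_Zn_sum => k.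
by rewrite Zn_sum_cint//; apply: le_lt_trans (Fb k) _; rewrite ltry.
Qed.

(** * Orthonormality of the characters of the torus *)

Lemma fine_probability_setT d (T : measurableType d) (R : realType)
  (P : probability T R) : fine (P setT) = 1.
Proof. by rewrite probability_setT. Qed.

Lemma integral_cst_probability d (T : measurableType d) (R : realType)
  (P : probability T R) (r : R) : (\int[P]_x (cst r x)%:E = r%:E)%E.
Proof.
transitivity (r%:E * P setT)%E; first exact: (integral_cst P measurableT r%:E).
by rewrite probability_setT mule1.
Qed.

Section circle.
Context {R : realType}.

Lemma cis2pi_int (m : int) : cis2pi (m%:~R : R) = 1.
Proof.
have cis1 : cis2pi 1 = 1 :> R[i].
  by rewrite /cis2pi mulr1 mulr_natl cos_mulr2n sin_mulr2n cospi sinpi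
     mulr0 mul0rn sqrrN expr1n mulr2n addrK.
have nat_case k : cis2pi (k%:R : R) = 1.
  elim: k => [|k IH]; first by rewrite cis2pi0.
  by rewrite -addn1 natrD cis2piD IH cis1 mulr1.
case: m => k; first exact: nat_case.
by rewrite NegzE mulrNz -conj_cis2pi -pmulrn nat_case conjc1.
Qed.

(** Reduced to the nonnegative function [1 + f], whose uniform expectation is its
    Lebesgue integral over [0, 1]. *)
Lemma integral_uniform01 (f F : R -> R) : continuous f ->
  (forall x : R, is_derive x (1 : R) F (f x)) -> (forall x, `|f x| <= 1) ->
  \int[uniform_prob (@ltr01 R)]_x f x = F 1 - F 0.
Proof.
move=> cf dF f1; pose U := uniform_prob (@ltr01 R).
have mf : measurable_fun setT f by exact: continuous_measurable_fun.
have i1 : U.-integrable setT (EFin \o cst 1).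
  exact: finite_measure_integrable_cst.
have iF : U.-integrable setT (EFin \o f).
  apply: le_integrable i1 => //; first exact/measurable_EFinP.
  by move=> x _ /=; rewrite lee_fin normr1.
pose g x := 1 + f x.
have gint : \int[U]_x g x = 1 + F 1 - F 0.
  rewrite /Rintegral integral_uniform; last 2 first.
  - apply/measurable_EFinP; exact: measurable_funD.
  - by move=> x; rewrite lee_fin /g; have := f1 x; rewrite ler_norml; lra.
  rewrite subr0 invr1 mul1e.
  rewrite (@continuous_FTC2 _ g (fun x => x + F x)) ?ltr01//=; first by lra.
  - apply: continuous_subspaceT => x; apply: cvgD; [exact: cvg_cst|exact: cf].
  - have cG x : {for x, continuous (fun x => x + F x)}.
      apply: cvgD; first exact: cvg_id.
      by apply: differentiable_continuous; apply/derivable1_diffP; case: (dF x).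
    split; first by move=> x _; apply: derivableD => //; case: (dF x).
      exact: cvg_at_right_filter (cG 0).
    exact: cvg_at_left_filter (cG 1).
  - by move=> x _; rewrite derive1E; have := dF x => dFx; rewrite derive_val.
have : \int[U]_x g x = 1 + \int[U]_x f x.
  rewrite /g (RintegralD measurableT i1 iF) Rintegral_cst// mul1r.
  by rewrite fine_probability_setT.
by rewrite gint => /eqP; rewrite -addrA (inj_eq (addrI _)) => /eqP.
Qed.

Lemma cint_uniform_character (m : int) :
  cint (uniform_prob (@ltr01 R)) (fun x => cis2pi (x * m%:~R)) = (m == 0)%:R.
Proof.
have [->|m0] := eqVneq m 0.
  rewrite (_ : (fun x => _) = (fun=> 1)); last first.
    by apply/funext => x; rewrite mulr0 cis2pi0.
  rewrite /cint /= !Rintegral_cst// mul0r mul1r.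
  by rewrite fine_probability_setT.
pose c : R := 2 * pi * m%:~R.
have c0 : c != 0.
  by rewrite !mulf_neq0 ?intr_eq0 ?pnatr_eq0// gt_eqF// pi_gt0.
have cE x : 2 * pi * (x * m%:~R) = c * x by rewrite /c; ring.
have := cis2pi_int m; rewrite /cis2pi -/c => -[cosc sinc].
rewrite /cint /cis2pi /=; congr (_ +i* _).
- under eq_Rintegral do rewrite cE.
  have dF (x : R) : is_derive x (1 : R) (fun x => c^-1 * sin (c * x)) (cos (c * x)).
    by apply: is_derive_eq; rewrite /GRing.scale /=; field; exact: c0.
  rewrite (integral_uniform01 _ dF).
  + by rewrite mulr1 mulr0 sinc sin0 mulr0 subr0.
  + move=> x; apply: continuous_comp; first exact: mulrl_continuous.
    exact: continuous_cos.
  + by move=> x; rewrite ler_norml cos_geN1 cos_le1.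
- under eq_Rintegral do rewrite cE.
  have dF (x : R) : is_derive x (1 : R) (fun x => - (c^-1 * cos (c * x))) (sin (c * x)).
    by apply: is_derive_eq; rewrite /GRing.scale /=; field; exact: c0.
  rewrite (integral_uniform01 _ dF).
  + by rewrite mulr1 mulr0 cosc cos0 subrr.
  + move=> x; apply: continuous_comp; first exact: mulrl_continuous.
    exact: continuous_sin.
  + by move=> x; rewrite ler_norml sin_geN1 sin_le1.
Qed.

End circle.

Section torus_characters.
Context {R : realType}.

Lemma pairingD n (w : torus R n) (k l : Zn n) :
  pairing w (k + l) = pairing w k + pairing w l.
Proof.
by rewrite -big_split; apply: eq_bigr => i _; rewrite mxE intrD mulrDr.
Qed.

Lemma pairingN n (w : torus R n) (k : Zn n) : pairing w (- k) = - pairing w k.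
Proof.
by rewrite -sumrN; apply: eq_bigr => i _; rewrite mxE mulrNz mulrN.
Qed.

Lemma cmeasurable_cis2pi d (T : measurableType d) (p : T -> R) :
  measurable_fun setT p -> cmeasurable (fun x => cis2pi (p x)).
Proof.
move=> mp.
have m2p : measurable_fun setT (fun x => 2 * pi * p x).
  by apply: measurable_funM => //; exact: measurable_cst.
split; apply: measurableT_comp m2p.
  by apply: continuous_measurable_fun; exact: continuous_cos.
by apply: continuous_measurable_fun; exact: continuous_sin.
Qed.

Lemma cmeasurable_character n (k : Zn n) :
  cmeasurable (fun w : torus R n => cis2pi (pairing w k)).
Proof.
apply: cmeasurable_cis2pi; apply: measurable_sum => i.
by apply: measurable_funM; [exact: measurable_tnth|exact: measurable_cst].
Qed.

Lemma cintegrable_bounded d (T : measurableType d) (P : probability T R)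
  (F : T -> R[i]) (M : R) : cmeasurable F -> (forall x, normc (F x) <= M) ->
  cintegrable P F.
Proof.
move=> mF FM; apply: (@cintegrable_le _ _ _ _ _ (cst M)) => //.
by rewrite integral_cst_probability ltry.
Qed.

Lemma cint_distribution d d' (T : measurableType d) (T' : measurableType d')
    (P : probability T R) (X : {mfun T >-> T'}) (F : T' -> R[i]) :
  cmeasurable F -> cintegrable P (F \o X) ->
  cint (distribution P X) F = cint P (F \o X).
Proof.
move=> [m1 m2] iF; rewrite /cint /Rintegral; congr (fine _ +i* fine _).
  rewrite integral_pushforward//; first exact/measurable_EFinP.
  by rewrite preimage_setT; exact: cintegrable_Re iF.
rewrite integral_pushforward//; first exact/measurable_EFinP.
by rewrite preimage_setT; exact: cintegrable_Im iF.
Qed.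

(** Induction on the dimension: by Fubini the integral over the torus factors into
    one-dimensional ones, and exp(2 pi i m x) integrates over a period to 0
    unless m = 0. *)
Lemma cint_character n (k : Zn n) :
  cint (haar R n) (fun w => cis2pi (pairing w k)) = (k == 0)%:R.
Proof.
elim: n k => [|n IH] k.
  rewrite (thinmx0 k) eqxx (_ : (fun w => _) = (fun=> 1)); last first.
    by apply/funext => w; rewrite /pairing big_ord0 cis2pi0.
  rewrite /cint /= !Rintegral_cst// mul0r mul1r.
  by rewrite fine_probability_setT.
pose k' : Zn n := \row_i k 0 (lift ord0 i).
have pE p : pairing (torus_cons p) k = p.1 * (k 0 0)%:~R + pairing p.2 k' :> R.
  rewrite /pairing big_ord_recl; congr (_ * _ + _).
  by apply: eq_bigr => i _; rewrite mxE tnthS.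
pose U := uniform_prob (@ltr01 R).
pose G (p : measurableTypeR R * torus R n) :=
  cis2pi (p.1 * (k 0 0)%:~R + pairing p.2 k').
have GE : G = (fun w => cis2pi (pairing w k)) \o @torus_cons R n.
  by apply/funext => p /=; rewrite pE.
have [m1 m2] := cmeasurable_character k.
have mG : cmeasurable G.
  by rewrite GE; split; [exact: (measurableT_comp m1 (@measurable_torus_cons R n))|
    exact: (measurableT_comp m2 (@measurable_torus_cons R n))].
have iG : cintegrable (U \x haar R n)%E G.
  by apply: (@cintegrable_bounded _ _ _ _ 1) => // x; rewrite normc_cis2pi.
rewrite [LHS](@cint_distribution _ _ _ _ (U \x haar R n)%E (@torus_cons R n))//; last first.
  by rewrite -GE.
rewrite -GE.
rewrite cint_prod//.
transitivity (cint U (fun x => (k' == 0)%:R * cis2pi (x * (k 0 0)%:~R))).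
  apply: eq_cint => x; rewrite /G /=.
  under eq_cint do rewrite cis2piD.
  rewrite cintZ ?IH; first by rewrite mulrC.
  apply: (@cintegrable_bounded _ _ _ _ 1) => [|w]; first exact: cmeasurable_character.
  by rewrite normc_cis2pi.
rewrite cintZ; last first.
  apply: (@cintegrable_bounded _ _ _ _ 1) => [|x]; last by rewrite normc_cis2pi.
  apply: cmeasurable_cis2pi; apply: measurable_funM; first exact: measurable_id.
  exact: measurable_cst.
rewrite cint_uniform_character -natrM mulnb; congr (nat_of_bool _)%:R.
apply/idP/eqP => [/andP[/eqP k'0 /eqP k0]|k0].
  apply/rowP => i; rewrite mxE; case: (unliftP ord0 i) => [j ->|-> //].
  by move/rowP: k'0 => /(_ j); rewrite !mxE.
by rewrite /k' k0 mxE eqxx andbT; apply/eqP/rowP => i; rewrite !mxE.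
Qed.

End torus_characters.

(** * Rapidly decreasing functions are summable *)

Section rapid_decrease.
Context {R : realType}.

Let W (a : int) : R := ((1 + `|a%:~R|) ^+ 2)^-1.

Let W0 a : 0 <= W a.
Proof. by rewrite invr_ge0 exprn_ge0// addr_ge0. Qed.

(** Telescoping: 1 / (i + 1)^2 <= 1 / i - 1 / (i + 1) for i >= 1. *)
Let sum_inv_sqr N : \sum_(0 <= i < N.+1) ((i.+1%:R : R) ^+ 2)^-1 <= 2 - N.+1%:R^-1.
Proof.
elim: N => [|N IH]; first by rewrite big_nat1 expr1n invr1; lra.
rewrite big_nat_recr//=; apply: le_trans (lerD IH (lexx _)) _.
have x0 : 0 < N.+1%:R :> R by rewrite ltr0n.
have -> : N.+2%:R = N.+1%:R + 1 :> R by rewrite -addn1 natrD.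
move: (N.+1%:R : R) x0 => x x0.
have -> : 2 - (x + 1)^-1 = 2 - x^-1 + ((x + 1) ^+ 2)^-1 + (x * (x + 1) ^+ 2)^-1.
  by field; rewrite !gt_eqF//; lra.
by rewrite lerDl invr_ge0 mulr_ge0 ?exprn_ge0 ?addr_ge0 ?ltW.
Qed.

Let esum_nat (c : R) (a : nat -> int) : 0 <= c ->
  (forall i, i%:R <= `|(a i)%:~R| :> R) ->
  (\esum_(i in [set: nat]) (c * W (a i))%:E <= (c * 2)%:E)%E.
Proof.
move=> c0 ai; have cW i : (0 <= (c * W (a i))%:E)%E by rewrite lee_fin mulr_ge0.
rewrite -nneseries_esumT//; apply: lime_le; first exact: is_cvg_nneseries.
apply: nearW => N; rewrite sumEFin lee_fin -mulr_sumr ler_wpM2l//.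
apply: (@le_trans _ _ (\sum_(0 <= i < N.+1) ((i.+1%:R : R) ^+ 2)^-1)).
  rewrite [leRHS]big_nat_recr//= -[leLHS]addr0 lerD ?invr_ge0 ?exprn_ge0//.
  apply: ler_sum => i _; rewrite /W lef_pV2 ?posrE ?exprn_gt0 ?ltr_pwDl//.
  by rewrite lerXn2r ?nnegrE ?addr_ge0// -addn1 natrD addrC lerD2l.
by apply: le_trans (sum_inv_sqr N) _; rewrite lerBlDr lerDl invr_ge0.
Qed.

Let esum_int (c : R) : 0 <= c ->
  (\esum_(a in [set: int]) (c * W a)%:E < +oo)%E.
Proof.
move=> c0; have cW a : (0 <= (c * W a)%:E)%E by rewrite lee_fin mulr_ge0.
rewrite (esumID (range Posz))//.
rewrite !setTI (@reindex_esum _ _ _ [set: nat] (range Posz) Posz); last first.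
  by split => //; move=> i j _ _ [].
rewrite (@reindex_esum _ _ _ [set: nat] (~` range Posz) Negz); last first.
  split; first by move=> i _ /= [].
    by move=> i j _ _ [].
  by move=> [i|i] /= ni; [case: ni; exists i|exists i].
apply: lte_add_pinfty.
  apply: (le_lt_trans (esum_nat (a := Posz) c0 _)); last exact: ltry.
  by move=> i; rewrite -pmulrn ger0_norm.
apply: (le_lt_trans (esum_nat (a := Negz) c0 _)); last exact: ltry.
by move=> i; rewrite NegzE mulrNz normrN -pmulrn ger0_norm// ler_nat.
Qed.

Let cons_Zn n (p : int * Zn n) : Zn n.+1 :=
  \row_j (if unlift ord0 j is Some i then p.2 0 i else p.1).

(** Splitting off the first coordinate, the sum factors as a product of n copies
    of a convergent series over Z. *)
Let esum_prod n :
  (\esum_(k in [set: Zn n]) (\prod_(i < n) W (k 0 i))%:E < +oo)%E.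
Proof.
elim: n => [|n IH].
  rewrite (_ : [set: Zn 0] = [set 0]); last first.
    by apply/seteqP; split => // k _; rewrite [k]thinmx0.
  by rewrite esum_set1 big_ord0 ?ltry// lee_fin.
have P0 n' (v : Zn n') : 0 <= \prod_(i < n') W (v 0 i) by exact: prodr_ge0.
set S := (\esum_(k in _) _)%E in IH.
have S0 : (0 <= S)%E by apply: esum_ge0 => k _; rewrite lee_fin.
rewrite (@reindex_esum _ _ _ ([set: int] `*`` (fun=> [set: Zn n])) setT (@cons_Zn n));
  last first.
  split => //.
    move=> [a v] [b u] _ _ /rowP e; congr (_, _).
      by have := e ord0; rewrite !mxE unlift_none.
    by apply/rowP => i; have := e (lift ord0 i); rewrite !mxE liftK.
  move=> k _; exists (k 0 0, \row_i k 0 (lift ord0 i)) => //.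
  apply/rowP => j; rewrite !mxE; case: unliftP => [i ->|->//].
  by rewrite mxE.
rewrite (eq_esum (b := fun p : int * Zn n => (W p.1 * \prod_(i < n) W (p.2 0 i))%:E)); last first.
  move=> [a v] _; rewrite big_ord_recl mxE unlift_none; congr (_ * _)%:E.
  by apply: eq_bigr => i _; rewrite mxE liftK.
rewrite -(@esum_esum _ _ _ setT (fun=> setT)
    (fun a (v : Zn n) => (W a * \prod_(i < n) W (v 0 i))%:E)); last first.
  by move=> a v _ _; rewrite lee_fin mulr_ge0.
rewrite (eq_esum (b := fun a => (fine S * W a)%:E)); last first.
  move=> a _; rewrite -integral_counting_Zn; last first.
    by move=> k; rewrite lee_fin mulr_ge0.
  under eq_integral do rewrite EFinM.
  rewrite ge0_integralZl//.
    rewrite integral_counting_Zn -/S; last by move=> k; rewrite lee_fin.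
    by rewrite EFinM fineK ?ge0_fin_numE// muleC.
    by move=> k _; rewrite lee_fin.
  by rewrite lee_fin.
by apply: esum_int; exact: fine_ge0.
Qed.

(** Decay of order 2n suffices: (1 + |k|)^(2n) dominates the product over i of
    (1 + |k_i|)^2, whose inverse is summable over Z^n. *)
Lemma rapidly_decreasing_in_l1 n (g : Zn n -> R[i]) :
  rapidly_decreasing g -> in_l1 g.
Proof.
move=> /(_ (2 * n)%N)[C gC].
have C0 : 0 <= C.
  by apply: le_trans (gC 0); rewrite mulr_ge0 ?normc_ge0// exprn_ge0// addr_ge0 ?sqrtr_ge0.
apply: (@in_l1_le _ _ _ (fun k => C * \prod_(i < n) W (k 0 i))); last first.
  by apply: esumZl_lty => // k; exact: prodr_ge0.
move=> k; rewrite /W prodfV ler_pdivlMr; last first.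
  by apply: prodr_gt0 => i _; rewrite exprn_gt0// ltr_pwDl.
rewrite mulrC; apply: le_trans (gC k); rewrite ler_wpM2r ?normc_ge0//.
rewrite exprM -[X in _ <= _ ^+ X]card_ord -prodr_const; apply: ler_prod => i _.
rewrite exprn_ge0 ?addr_ge0//= lerXn2r ?nnegrE ?addr_ge0 ?sqrtr_ge0//.
rewrite lerD2l -sqrtr_sqr ler_wsqrtr// (bigD1 i)//= lerDl.
by apply: sumr_ge0 => j _; exact: sqr_ge0.
Qed.

End rapid_decrease.

(** * Fourier series and Parseval's identity *)

Section fourier_series.
Context {R : realType} {n : nat}.
Implicit Types (u v : Zn n -> R[i]) (k m : Zn n) (w : torus R n).

Definition character w k : R[i] := cis2pi (pairing w k).

Definition fourier u w : R[i] := Zn_sum (fun k => u k * (character w k)^*%C).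

Lemma normc_character w k : normc (character w k) = 1.
Proof. exact: normc_cis2pi. Qed.

Lemma characterD w k m : character w (k + m) = character w k * character w m.
Proof. by rewrite /character pairingD cis2piD. Qed.

Lemma characterN w k : character w (- k) = (character w k)^*%C.
Proof. by rewrite /character pairingN conj_cis2pi. Qed.

Lemma characterVr w k : character w k * (character w k)^*%C = 1.
Proof.
rewrite -characterN -characterD subrr /character.
suff -> : pairing w 0 = 0 by rewrite cis2pi0.
by apply: (addrI (pairing w 0)); rewrite -pairingD !addr0.
Qed.

Lemma in_l1_twist u w : in_l1 u -> in_l1 (fun k => u k * (character w k)^*%C).
Proof. by apply: in_l1_le => k; rewrite normcM normc_conj normc_character mulr1. Qed.

(** Term-by-term integration under a summable majorant. *)
Lemma torus_integral_Zn_sum (F : torus R n -> Zn n -> R[i]) (b : Zn n -> R) :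
  (forall k, cmeasurable (fun w => F w k)) ->
  (forall w k, normc (F w k) <= b k) ->
  (\esum_(k in [set: Zn n]) (b k)%:E < +oo)%E ->
  cintegrable (haar R n) (fun w => Zn_sum (F w)) /\
  torus_integral (fun w => Zn_sum (F w)) =
  Zn_sum (fun k => torus_integral (fun w => F w k)).
Proof.
move=> mF Fb bfin.
have Fl1 w : in_l1 (F w) by exact: in_l1_le (Fb w) bfin.
have iFb k : (\int[haar R n]_w (normc (F w k))%:E <= (b k)%:E)%E.
  rewrite -(integral_cst_probability (haar R n) (b k)).
  apply: ge0_le_integral => //.
  - by move=> w _; rewrite lee_fin normc_ge0.
  - exact: measurable_normc.
  - by apply/measurable_EFinP; exact: measurable_cst.
  - by move=> w _; rewrite lee_fin.
split; first exact: (cintegrable_Zn_sum mF Fl1 iFb bfin).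
exact: (cint_Zn_sum mF Fl1 iFb bfin).
Qed.

Lemma cmeasurable_fourier u : in_l1 u -> cmeasurable (fourier u).
Proof.
move=> u1; have [] := @torus_integral_Zn_sum
  (fun w k => u k * (character w k)^*%C) (fun k => normc (u k)) _ _ u1.
- move=> k; apply: cmeasurableM; first exact: cmeasurable_cst.
  exact/cmeasurable_conj/cmeasurable_character.
- by move=> w k; rewrite normcM normc_conj normc_character mulr1.
- by case.
Qed.

Lemma normc_fourier u w : in_l1 u ->
  normc (fourier u w) <= 2 * fine (\esum_(k in [set: Zn n]) (normc (u k))%:E).
Proof.
move=> u1; apply: le_trans (normc_Zn_sum (in_l1_twist w u1)) _.
rewrite ler_pM2l// le_eqVlt; apply/orP; left; apply/eqP; congr fine.
by apply: eq_esum => k _; rewrite normcM normc_conj normc_character mulr1.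
Qed.

(** Integrated term by term, character orthogonality leaves a single summand. *)
Lemma fourier_coefficient u k : in_l1 u ->
  torus_integral (fun w => character w k * fourier u w) = u k.
Proof.
move=> u1.
have -> : (fun w => character w k * fourier u w) =
    (fun w => Zn_sum (fun j => u j * character w (k - j))).
  apply/funext => w; rewrite -Zn_sumZ; last exact: in_l1_twist.
  by apply: eq_Zn_sum => j; rewrite characterD characterN mulrCA.
have [] := @torus_integral_Zn_sum (fun w j => u j * character w (k - j))
    (fun j => normc (u j)) _ _ u1.
- by move=> j; apply: cmeasurableM; [exact: cmeasurable_cst|exact: cmeasurable_character].
- by move=> w j; rewrite normcM normc_character mulr1.
move=> _ ->.
have E j : torus_integral (fun w => u j * character w (k - j)) = u j * (k == j)%:R.
  rewrite [LHS](@cintZ _ _ _ (haar R n)); last first.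
    apply: (@cintegrable_bounded _ _ _ _ _ 1); first exact: cmeasurable_character.
    by move=> w; rewrite normc_character.
  by rewrite [X in _ * X]cint_character subr_eq0.
rewrite (eq_Zn_sum E) (@Zn_sum1 _ _ k) ?eqxx ?mulr1// => j.
by rewrite eq_sym => /negbTE ->; rewrite mulr0.
Qed.

(** Expanding only the first series in the integrand reduces the identity to the
    Fourier coefficients of the second. *)
Lemma parseval u v : in_l1 u -> in_l1 v ->
  torus_integral (fun w => fourier u w * (fourier v w)^*%C) =
  Zn_sum (fun k => u k * (v k)^*%C).
Proof.
move=> u1 v1.
have -> : (fun w => fourier u w * (fourier v w)^*%C) =
    (fun w => Zn_sum (fun k => u k * (character w k * fourier v w)^*%C)).
  apply/funext => w; rewrite mulrC -Zn_sumZ; last exact: in_l1_twist.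
  by apply: eq_Zn_sum => k; rewrite conjcM mulrCA [_^*%C * _]mulrC.
pose B := 2 * fine (\esum_(k in [set: Zn n]) (normc (v k))%:E).
have B0 : 0 <= B.
  by rewrite mulr_ge0// fine_ge0// esum_ge0// => k _; rewrite lee_fin normc_ge0.
have mv k : cmeasurable (fun w => character w k * fourier v w).
  by apply: cmeasurableM; [exact: cmeasurable_character|exact: cmeasurable_fourier].
have [] := @torus_integral_Zn_sum
    (fun w k => u k * (character w k * fourier v w)^*%C)
    (fun k => B * normc (u k)).
- move=> k; apply: cmeasurableM; first exact: cmeasurable_cst.
  exact/cmeasurable_conj/mv.
- move=> w k; rewrite normcM normc_conj normcM normc_character mul1r mulrC.
  by rewrite ler_wpM2r ?normc_ge0// normc_fourier.
- by apply: esumZl_lty => // k; exact: normc_ge0.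
move=> _ ->; apply: eq_Zn_sum => k.
have iv : cintegrable (haar R n) (fun w => character w k * fourier v w).
  apply: (@cintegrable_bounded _ _ _ _ _ B) => // w.
  by rewrite normcM normc_character mul1r normc_fourier.
rewrite [LHS](@cintZ _ _ _ (haar R n)); last first.
  apply: (@cintegrable_bounded _ _ _ _ _ B); first exact: cmeasurable_conj.
  by move=> w; rewrite normc_conj normcM normc_character mul1r normc_fourier.
rewrite [X in _ * X](@cint_conj _ _ _ (haar R n))//; congr (_ * _^*%C).
exact: fourier_coefficient.
Qed.

End fourier_series.

(** * The localization operator as a multiplier *)

Section localization_multiplier.
Context {R : realType} {n : nat}.
Variables g1 g2 alpha : Zn n -> R[i].
Hypotheses (g1l1 : in_l1 g1) (g2l1 : in_l1 g2) (al : in_linfty alpha).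
Implicit Types (f h g : Zn n -> R[i]) (m k : Zn n).

Definition window_product g f m : Zn n -> R[i] :=
  fun k => f k * (g (k - m))^*%C.

Lemma in_l1_window_product g f m : in_l1 g -> in_linfty f ->
  in_l1 (window_product g f m).
Proof.
move=> g1'; move/in_linfty_mul_l1; apply.
exact/in_l1_conj/in_l1_reindex/g1'/bij_translate.
Qed.

(** The windowed function absorbs the translate of the window, leaving a plain
    Fourier series in w. *)
Lemma stftE g f m w : stft g f m w = fourier (window_product g f m) w.
Proof.
apply: eq_Zn_sum => k.
by rewrite /modulation /translation conjcM mulrCA mulrC.
Qed.

Lemma convolution_modulationE f m w : in_linfty f ->
  convolution (modulation w (involution g1)) f m =
  character w m * fourier (window_product g1 f m) w.
Proof.
move=> fb; rewrite -Zn_sumZ; last exact/in_l1_twist/in_l1_window_product.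
apply: eq_Zn_sum => j.
rewrite /modulation /involution -/(character w (m - j)) characterD characterN opprB.
by rewrite /window_product; ring.
Qed.

Lemma convolution_reflectionE h m w : in_linfty h ->
  convolution (fun j => (modulation w g2 (- j))^*%C) h m =
  character w m * fourier (window_product g2 h m) w.
Proof.
move=> hb; rewrite -Zn_sumZ; last exact/in_l1_twist/in_l1_window_product.
apply: eq_Zn_sum => j.
rewrite /modulation -/(character w (- (m - j))) opprB conjcM -(characterN w (j - m)) opprB.
by rewrite characterD characterN /window_product; ring.
Qed.

(** The unimodular factors e(w.m) of the two convolutions cancel. *)
Lemma paraproductE f h m : in_linfty f -> in_linfty h ->
  paraproduct g1 g2 f h m =
  torus_integral (fun w => stft g1 f m w * (stft g2 h m w)^*%C).
Proof.
move=> fb hb; congr torus_integral; apply/funext => w.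
rewrite convolution_modulationE// convolution_reflectionE// !stftE conjcM.
by rewrite mulrACA characterVr mul1r.
Qed.

Definition window_correlation k : R[i] := (g1 k)^*%C * g2 k.

Lemma in_l1_window_correlation : in_l1 window_correlation.
Proof.
apply: in_linfty_mul_l1 => //; have [M gM] := in_l1_bounded g1l1.
by exists M => k; rewrite normc_conj.
Qed.

Definition multiplier k : R[i] :=
  Zn_sum (fun m => alpha m * window_correlation (k - m)).

Let in_l1_multiplier k : in_l1 (fun m => alpha m * window_correlation (k - m)).
Proof.
apply: in_linfty_mul_l1 => //.
exact: in_l1_reindex (bij_reflect k) in_l1_window_correlation.
Qed.

(** The sum defining the multiplier is dominated, uniformly in k, by the sup norm
    of alpha times the l^1 norm of the window correlation, a sum invariant under
    reflection and translation. *)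
Lemma multiplier_bounded : in_linfty multiplier.
Proof.
have [M aM] := al.
have M0 : 0 <= M by apply: le_trans (aM 0); exact: normc_ge0.
pose S := (\esum_(k in [set: Zn n]) (M * normc (window_correlation k))%:E)%E.
have Sfin : (S < +oo)%E.
  by apply: esumZl_lty => // [k|]; [exact: normc_ge0|exact: in_l1_window_correlation].
exists (2 * fine S) => k.
apply: le_trans (normc_Zn_sum (in_l1_multiplier k)) _.
rewrite ler_pM2l// fine_le//.
- rewrite ge0_fin_numE; first exact: in_l1_multiplier.
  by apply: esum_ge0 => m _; rewrite lee_fin normc_ge0.
- rewrite ge0_fin_numE//.
  by apply: esum_ge0 => m _; rewrite lee_fin mulr_ge0// normc_ge0.
rewrite /S -(esum_reindex (fun l => (M * normc (window_correlation l))%:E) (bij_reflect k)).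
by apply: le_esum => m _; rewrite lee_fin normcM ler_wpM2r ?normc_ge0.
Qed.

Lemma integral_stft f h m : in_linfty f -> in_linfty h ->
  torus_integral (fun w => stft g1 f m w * (stft g2 h m w)^*%C) =
  Zn_sum (fun k => (f k * (h k)^*%C) * window_correlation (k - m)).
Proof.
move=> fb hb; under [X in torus_integral X]eq_fun do rewrite !stftE.
rewrite parseval; [|exact: in_l1_window_product..].
apply: eq_Zn_sum => k; rewrite /window_product /window_correlation conjcM conjcK.
by ring.
Qed.

Lemma cintegrable_stft f h m : in_linfty f -> in_linfty h ->
  cintegrable (haar R n) (fun w => stft g1 f m w * (stft g2 h m w)^*%C).
Proof.
move=> fb hb.
have f1 := in_l1_window_product m g1l1 fb.
have h1 := in_l1_window_product m g2l1 hb.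
rewrite (_ : (fun w => _) = (fun w => fourier (window_product g1 f m) w *
    (fourier (window_product g2 h m) w)^*%C)); last first.
  by apply/funext => w; rewrite !stftE.
apply: cintegrable_bounded.
  apply: cmeasurableM; first exact: cmeasurable_fourier.
  exact/cmeasurable_conj/cmeasurable_fourier.
move=> w; rewrite normcM normc_conj.
by apply: ler_pM; rewrite ?normc_ge0//; exact: normc_fourier.
Qed.

(** The double sum of alpha(m) f(k) conj(h(k)) G(k - m), with G the window
    correlation, read in its two orders: summing over m first gives the multiplier,
    summing over k first gives the integral of short-time Fourier transforms. *)
Lemma multiplier_formula f h : in_l2 f -> in_l2 h ->
  l2_inner (fun k => multiplier k * f k) h =
  Zn_sum (fun m => alpha m *
    torus_integral (fun w => stft g1 f m w * (stft g2 h m w)^*%C)).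
Proof.
move=> f2 h2; have fb := in_l2_bounded f2; have hb := in_l2_bounded h2.
pose p k := f k * (h k)^*%C.
have p1 : in_l1 p by exact/in_l2_mul/in_l2_conj.
have G1 := in_l1_window_correlation.
have [N GN] := in_l1_bounded G1.
have row1 m : in_l1 (fun k => p k * window_correlation (k - m)).
  rewrite (_ : (fun k => _) = (fun k => window_correlation (k - m) * p k)).
    by apply: in_linfty_mul_l1 => //; exists N => k.
  by apply/funext => k; rewrite mulrC.
transitivity (Zn_sum (fun k => Zn_sum (fun m =>
    alpha m * (p k * window_correlation (k - m))))).
  apply: eq_Zn_sum => k; rewrite -mulrA mulrC -Zn_sumZ//.
  by apply: eq_Zn_sum => m; rewrite mulrCA.
have [M aM] := al.
have M0 : 0 <= M by apply: le_trans (aM 0); exact: normc_ge0.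
pose S := (\esum_(k in [set: Zn n]) (M * normc (window_correlation k))%:E)%E.
have S0 : (0 <= S)%E.
  by apply: esum_ge0 => m _; rewrite lee_fin mulr_ge0// normc_ge0.
have Sfin : (S < +oo)%E by apply: esumZl_lty => // k; exact: normc_ge0.
rewrite -(@Zn_sum_swap _ _ _ (fun k => fine S * normc (p k))); first last.
- by apply: esumZl_lty => [|k|//]; [exact: fine_ge0|exact: normc_ge0].
- move=> k; rewrite EFinM fineK ?ge0_fin_numE//.
  rewrite /S -(esum_reindex (fun l => (M * normc (window_correlation l))%:E) (bij_reflect k)).
  rewrite -!integral_counting_Zn; last 2 first.
  + by move=> m; rewrite lee_fin normc_ge0.
  + by move=> m; rewrite lee_fin mulr_ge0// normc_ge0.
  rewrite -ge0_integralZr//; last 2 first.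
  + by move=> m _; rewrite lee_fin mulr_ge0// normc_ge0.
  + by rewrite lee_fin normc_ge0.
  apply: ge0_le_integral => //.
  + by move=> m _; rewrite lee_fin normc_ge0.
  + move=> m _; rewrite -EFinM lee_fin (normcM (alpha m)) (normcM (p k)) mulrCA [leRHS]mulrC.
    by rewrite ler_wpM2l ?normc_ge0// ler_wpM2r ?normc_ge0.
- move=> m; apply: in_linfty_mul_l1 (row1 m).
  by exists M => k; exact: aM.
apply: eq_Zn_sum => m; rewrite Zn_sumZ//; congr (_ * _).
by rewrite integral_stft.
Qed.

Variable s : Zn n -> torus R n -> R[i].
Hypothesis sE : forall m w, s m w = alpha m.

Lemma symbol_integral f h m : in_linfty f -> in_linfty h ->
  torus_integral (fun w => s m w * stft g1 f m w * (stft g2 h m w)^*%C) =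
  alpha m * torus_integral (fun w => stft g1 f m w * (stft g2 h m w)^*%C).
Proof.
move=> fb hb; rewrite -[RHS](@cintZ _ _ _ (haar R n)); last exact: cintegrable_stft.
by congr torus_integral; apply/funext => w; rewrite sE mulrA.
Qed.

Lemma is_localization_multiplier f : in_l2 f ->
  is_localization s g1 g2 f (fun k => multiplier k * f k).
Proof.
move=> f2; split; first exact/in_linfty_mul_l2/f2/multiplier_bounded.
move=> h h2; rewrite multiplier_formula//; apply: eq_Zn_sum => m.
by rewrite symbol_integral//; exact: in_l2_bounded.
Qed.

(** Testing against point masses shows that the representing element of l^2 is
    unique. *)
Lemma localization_multiplier f : in_l2 f ->
  localization s g1 g2 f = (fun k => multiplier k * f k).
Proof.
move=> f2; apply: xget_unique; first exact: is_localization_multiplier.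
move=> u [u2 uE]; have [_ cE] := is_localization_multiplier f2.
apply/funext => k; pose dk : Zn n -> R[i] := fun j => (j == k)%:R.
have dk2 : in_l2 dk.
  rewrite /in_l2 (eq_esum (b := fun j => if j \in [set k] then 1%:E else 0%E)).
    by rewrite -(esum_mkcond [set k] (fun=> 1%:E)) esum_set1 ?lee_fin// ltry.
  move=> j _; rewrite /dk; have [->|jk] := eqVneq j k.
    by rewrite mem_set// normc1 expr1n.
  by rewrite memNset ?normc0 ?expr0n//; exact/eqP.
have inner v : l2_inner v dk = v k.
  rewrite /l2_inner (@Zn_sum1 _ _ k) /dk ?eqxx ?conjc1 ?mulr1// => j /negbTE ->.
  by rewrite conjc0 mulr0.
by have := uE _ dk2; rewrite -(cE _ dk2) !inner.
Qed.

(** After the reindexing m = k - j the integrand is a sum of multiples of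
    e(w.k) times the Fourier series of the m-th windowed function, whose integral
    is a Fourier coefficient. *)
Lemma multiplier_integral f k : in_l2 f ->
  multiplier k * f k = torus_integral (fun w =>
    convolution
      (fun j => alpha j * convolution (modulation w (involution g1)) f j)
      (modulation w g2) k).
Proof.
move=> f2; have fb := in_l2_bounded f2.
have [M aM] := al; have [L fL] := fb.
have M0 : 0 <= M by apply: le_trans (aM 0); exact: normc_ge0.
have L0 : 0 <= L by apply: le_trans (fL 0); exact: normc_ge0.
have f1 m : in_l1 (window_product g1 f m) by exact: in_l1_window_product.
pose T w m := (alpha m * g2 (k - m)) *
  (character w k * fourier (window_product g1 f m) w).
have -> : (fun w => convolution
      (fun j => alpha j * convolution (modulation w (involution g1)) f j)
      (modulation w g2) k) = (fun w => Zn_sum (T w)).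
  apply/funext => w; rewrite -[RHS](Zn_sum_reindex _ (bij_reflect k)).
  apply: eq_Zn_sum => j; rewrite convolution_modulationE// /T subKr.
  have -> : character w k = character w (k - j) * character w j.
    by rewrite -characterD subrK.
  by rewrite /modulation -/(character w j); ring.
pose S := (\esum_(i in [set: Zn n]) (L * normc (g1 i))%:E)%E.
have S0 : (0 <= S)%E.
  by apply: esum_ge0 => m _; rewrite lee_fin mulr_ge0// normc_ge0.
have Sfin : (S < +oo)%E by apply: esumZl_lty => // i; exact: normc_ge0.
have fourierS m w : normc (fourier (window_product g1 f m) w) <= 2 * fine S.
  apply: le_trans (normc_fourier w (f1 m)) _; rewrite ler_pM2l// fine_le//.
  - by rewrite ge0_fin_numE//; [exact: f1|apply: esum_ge0 => i _; rewrite lee_fin normc_ge0].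
  - by rewrite ge0_fin_numE.
  rewrite /S -(esum_reindex (fun l => (L * normc (g1 l))%:E) (bij_translate m)).
  by apply: le_esum => i _; rewrite lee_fin normcM normc_conj ler_wpM2r ?normc_ge0.
have mF m : cmeasurable (fun w => character w k * fourier (window_product g1 f m) w).
  by apply: cmeasurableM; [exact: cmeasurable_character|exact: cmeasurable_fourier].
have [] := @torus_integral_Zn_sum _ _ T
    (fun m => (M * (2 * fine S)) * normc (g2 (k - m))).
- by move=> m; apply: cmeasurableM; [exact: cmeasurable_cst|exact: mF].
- move=> w m; rewrite !normcM normc_character mul1r -mulrA mulrCA [leRHS]mulrC.
  by rewrite ler_wpM2l ?normc_ge0// ler_pM ?normc_ge0.
- apply: esumZl_lty => [|m|]; last exact: in_l1_reindex (bij_reflect k) g2l1.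
    by rewrite !mulr_ge0// fine_ge0.
  exact: normc_ge0.
move=> _ ->; rewrite mulrC -Zn_sumZ//; apply: eq_Zn_sum => m.
rewrite [RHS](@cintZ _ _ _ (haar R n)); last first.
  apply: (@cintegrable_bounded _ _ _ _ _ (2 * fine S)) => // w.
  by rewrite normcM normc_character mul1r.
rewrite [X in _ = _ * X]fourier_coefficient// /window_product /window_correlation.
by ring.
Qed.

End localization_multiplier.

Theorem mainTheorem18 (R : realType) (n : nat) (g1 g2 alpha : Zn n -> R[i])
    (s : Zn n -> torus R n -> R[i])
    (hg1 : rapidly_decreasing g1) (hg2 : rapidly_decreasing g2)
    (halpha : in_linfty alpha) (hs : forall m w, s m w = alpha m) :
  (forall f, in_l2 f -> forall k,
     localization s g1 g2 f k =
     torus_integral (fun w =>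
       convolution
         (fun j => alpha j * convolution (modulation w (involution g1)) f j)
         (modulation w g2) k))
  /\
  (forall f h, in_l2 f -> in_l2 h ->
     l2_inner (localization s g1 g2 f) h =
     Zn_sum (fun k => alpha k * paraproduct g1 g2 f h k)).
Proof.
have g1l1 := rapidly_decreasing_in_l1 hg1.
have g2l1 := rapidly_decreasing_in_l1 hg2.
split=> [f f2 k|f h f2 h2].
  by rewrite (localization_multiplier g1l1 g2l1 halpha hs)// multiplier_integral.
rewrite (localization_multiplier g1l1 g2l1 halpha hs f2).
rewrite (multiplier_formula g1l1 g2l1 halpha f2 h2).
by apply: eq_Zn_sum => m; rewrite paraproductE//; exact: in_l2_bounded.
Qed.
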